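(* Let $S$ be an additively idempotent semiring whose only strongly subtractive left ideals are the two trivial ones, $0$ and $S$. A left $S$-semimodule $M$ is e-injective if and only if $M$ possesses an infinite element $\infty\in M$ such that $s\infty=\infty$ for all $s\in S\setminus\{0\}$.
   Context: A semiring is $(S,+,\cdot,0,1)$ with $(S,+,0)$ a commutative monoid, $(S,\cdot,1)$ a monoid, multiplication distributing over addition on both sides, and $0s=0=s0$ for all $s$. It is additively idempotent if $s+s=s$ for all $s\in S$. A left $S$-semimodule is a commutative monoid $(M,+,0)$ with a scalar multiplication $S\times M\to M$ satisfying $(ss')m=s(s'm)$, $s(m+m')=sm+sm'$, $(s+s')m=sm+s'm$, $1m=m$, $s0=0=0m$. Homomorphisms preserve $+$, $0$ and scalar multiplication; ${}_S\mathcal{M}$ is the category of left $S$-semimodules and $\mathcal{M}$ the category of commutative monoids. A left ideal $I$ of $S$ (a subsemimodule of ${}_SS$) is strongly subtractive if $a+b\in I$ implies $a,b\in I$ for all $a,b\in S$. An element $\infty\in M$ is infinite if $\infty+m=\infty$ for all $m\in M$. A sequence $0\to A\xrightarrow{f}B\xrightarrow{g}C\to 0$ in ${}_S\mathcal{M}$ (or in $\mathcal{M}$) is short exact if $f$ is a categorical kernel of $g$ and $g$ is a categorical cokernel of $f$ (kernels and cokernels in the sense of categories with zero morphisms). $M\in{}_S\mathcal{M}$ is e-injective if the contravariant functor $\mathrm{Hom}_S(-,M):{}_S\mathcal{M}\to\mathcal{M}$ sends every short exact sequence $0\to A\to B\to C\to 0$ to a short exact sequence $0\to\mathrm{Hom}_S(C,M)\to\mathrm{Hom}_S(B,M)\to\mathrm{Hom}_S(A,M)\to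 0$ in $\mathcal{M}$. *)

(* Defs.v *)
From HB Require Import structures.
From mathcomp Require Import all_boot all_order all_algebra.
From mathcomp Require Import boolp.

Set Implicit Arguments.
Unset Strict Implicit.
Unset Printing Implicit Defensive.

Import GRing.Theory.
Local Open Scope ring_scope.

(* [S^o] is [S] as a left semimodule over itself.  Subsets are boolean          *)
(* predicates, which by excluded middle and choice (boolp) are all subsets;     *)
(* likewise every type is a choiceType, so [lSemiModType S] and [nmodType]      *)
(* impose nothing beyond the algebraic axioms.                                  *)
Definition left_ideal (S : pzSemiRingType) (I : {pred S^o}) : Prop :=
  GRing.subsemimod_closed I.

Definition strongly_subtractive (S : pzSemiRingType) (I : {pred S^o}) : Prop :=
  forall a b : S^o, a + b \in I -> a \in I /\ b \in I.

Definition infinite_element (M : nmodType) (oo : M) : Prop :=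
  forall m : M, oo + m = oo.

Section SemimoduleCategory.
Variable S : pzSemiRingType.

Definition lsmod_kernel (A B C : lSemiModType S)
    (f : {linear A -> B}) (g : {linear B -> C}) : Prop :=
  g \o f =1 \0 /\
  forall (D : lSemiModType S) (h : {linear D -> B}), g \o h =1 \0 ->
    exists k : {linear D -> A},
      f \o k =1 h /\ forall k' : {linear D -> A}, f \o k' =1 h -> k' =1 k.

Definition lsmod_cokernel (A B C : lSemiModType S)
    (f : {linear A -> B}) (g : {linear B -> C}) : Prop :=
  g \o f =1 \0 /\
  forall (D : lSemiModType S) (h : {linear B -> D}), h \o f =1 \0 ->
    exists k : {linear C -> D},
      k \o g =1 h /\ forall k' : {linear C -> D}, k' \o g =1 h -> k' =1 k.

Definition lsmod_short_exact (A B C : lSemiModType S)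
    (f : {linear A -> B}) (g : {linear B -> C}) : Prop :=
  lsmod_kernel f g /\ lsmod_cokernel f g.

End SemimoduleCategory.

Definition nmod_kernel (A B C : nmodType)
    (f : {additive A -> B}) (g : {additive B -> C}) : Prop :=
  g \o f =1 \0 /\
  forall (D : nmodType) (h : {additive D -> B}), g \o h =1 \0 ->
    exists k : {additive D -> A},
      f \o k =1 h /\ forall k' : {additive D -> A}, f \o k' =1 h -> k' =1 k.

Definition nmod_cokernel (A B C : nmodType)
    (f : {additive A -> B}) (g : {additive B -> C}) : Prop :=
  g \o f =1 \0 /\
  forall (D : nmodType) (h : {additive B -> D}), h \o f =1 \0 ->
    exists k : {additive C -> D},
      k \o g =1 h /\ forall k' : {additive C -> D}, k' \o g =1 h -> k' =1 k.

Definition nmod_short_exact (A B C : nmodType)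
    (f : {additive A -> B}) (g : {additive B -> C}) : Prop :=
  nmod_kernel f g /\ nmod_cokernel f g.

Definition lsmod_hom (S : pzSemiRingType) (A M : lSemiModType S) : Type :=
  {linear A -> M}.

Section HomMonoid.
Variables (S : pzSemiRingType) (A M : lSemiModType S).

HB.instance Definition _ := gen_eqMixin (lsmod_hom A M).
HB.instance Definition _ := gen_choiceMixin (lsmod_hom A M).

Lemma hom_eqP (phi psi : {linear A -> M}) : phi =1 psi -> phi = psi.
Proof.
case: phi psi => [f [[a] [b]]] [g [[c] [d]]] /= /funext efg.
rewrite -{}efg in c d *.
by rewrite (Prop_irrelevance a c) (Prop_irrelevance b d).
Qed.

Definition hom_zero : lsmod_hom A M := (\0 : A -> M).

Definition hom_add (phi psi : lsmod_hom A M) : lsmod_hom A M :=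
  (phi : {linear A -> M}) \+ (psi : {linear A -> M}).

Lemma hom_addA : associative hom_add.
Proof. by move=> p q r; apply: hom_eqP => x /=; rewrite addrA. Qed.

Lemma hom_addC : commutative hom_add.
Proof. by move=> p q; apply: hom_eqP => x /=; rewrite addrC. Qed.

Lemma hom_add0 : left_id hom_zero hom_add.
Proof. by move=> p; apply: hom_eqP => x /=; rewrite add0r. Qed.

HB.instance Definition _ :=
  GRing.isNmodule.Build (lsmod_hom A M) hom_addA hom_addC hom_add0.

End HomMonoid.

Section HomFunctor.
Variables (S : pzSemiRingType) (M A B : lSemiModType S) (f : {linear A -> B}).

Definition hom_map (phi : lsmod_hom B M) : lsmod_hom A M :=
  (phi : {linear B -> M}) \o f.

Lemma hom_map_is_nmod_morphism : nmod_morphism hom_map.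
Proof. by split=> [|p q]; apply: hom_eqP. Qed.

HB.instance Definition _ :=
  GRing.isNmodMorphism.Build (lsmod_hom B M) (lsmod_hom A M) hom_map
    hom_map_is_nmod_morphism.

End HomFunctor.

Arguments hom_map {S} M {A B} f phi.

Definition e_injective (S : pzSemiRingType) (M : lSemiModType S) : Prop :=
  forall (A B C : lSemiModType S) (f : {linear A -> B}) (g : {linear B -> C}),
    lsmod_short_exact f g ->
    nmod_short_exact (hom_map M g : {additive lsmod_hom C M -> lsmod_hom B M})
                     (hom_map M f : {additive lsmod_hom B M -> lsmod_hom A M}).

(* Main.v *)
Require Import Defs.
From HB Require Import structures.
From mathcomp Require Import all_boot all_order all_algebra.
From mathcomp Require Import boolp.

(** Over an additively idempotent [S] every semimodule [C] satisfies
    [c + d = 0 -> c = 0], so annihilators of elements of [C] are strongly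
    subtractive left ideals; by hypothesis they are trivial, i.e. [s c = 0] forces
    [s = 0] or [c = 0].  Hence, if [M] has an element [oo] as required and
    [0 -> A -> B -> C -> 0] is short exact, any [A -> M] extends to [B] by the
    value [oo] off [A], and the map [B -> M] that is [0] on [A] and [oo] off [A]
    factors through [C] and equalizes any two extensions.  Conversely, for the
    same reason [M] with a new absorbing point fixed by all nonzero scalars is a
    semimodule in which [M] is a kernel; extending the identity of [M] to it, the
    image of the new point is the required element. *)

Set Implicit Arguments.
Unset Strict Implicit.
Unset Printing Implicit Defensive.

Import GRing.Theory.
Local Open Scope ring_scope.

(** * Bundled morphisms obtained from plain maps *)

Lemma linear_of_semilinear (S : pzSemiRingType) (A B : lSemiModType S)
    (f : A -> B) :
  {morph f : x y / x + y} -> scalable f -> exists g : {linear A -> B}, g =1 f.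
Proof.
move=> fD fZ; pose mixin := GRing.isSemilinear.Build S A B _ f (fZ, fD).
pose g : {linear A -> B} := HB.pack f mixin.
by exists g.
Qed.

Lemma additive_of_morph (A B : nmodType) (f : A -> B) :
  Algebra.nmod_morphism f -> exists g : {additive A -> B}, g =1 f.
Proof.
move=> fA; pose mixin := GRing.isNmodMorphism.Build A B f fA.
pose g : {additive A -> B} := HB.pack f mixin.
by exists g.
Qed.

(** * Images of additive maps and surjectivity of cokernels *)

Section AdditiveImage.
Variables (A B : nmodType) (u : {additive A -> B}).

Definition additive_image : {pred B} := [pred y | `[< exists x, u x = y >]].

Lemma additive_image_nmod_closed : Algebra.nmod_closed additive_image.
Proof.
split=> [|x y]; first by apply/asboolP; exists 0; rewrite raddf0.
move=> /asboolP[a <-] /asboolP[b <-].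
by apply/asboolP; exists (a + b); rewrite raddfD.
Qed.

Record additive_image_type :=
  AdditiveImage { additive_image_val :> B; _ : additive_image_val \in additive_image }.

HB.instance Definition _ := [isSub for additive_image_val].
HB.instance Definition _ := [Choice of additive_image_type by <:].
HB.instance Definition _ := GRing.SubChoice_isSubNmodule.Build B _
  additive_image_type additive_image_nmod_closed.

End AdditiveImage.

(* The corestriction of [u] to its image factors through [u], and uniqueness of
   factorizations makes the resulting map a section of the inclusion. *)
Lemma nmod_cokernel_surjective (X A B : nmodType)
    (v : {additive X -> A}) (u : {additive A -> B}) :
  nmod_cokernel v u -> forall y, exists x, u x = y.
Proof.
move=> [uv0 coker] y.
have im x : u x \in additive_image u by apply/asboolP; exists x.
have [c cE] : exists c : {additive A -> additive_image_type u},
    c =1 (fun x => AdditiveImage (im x)).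
  apply: additive_of_morph; split=> [|x x']; apply: val_inj => /=.
    exact: raddf0.
  exact: raddfD.
have cv0 : c \o v =1 \0.
  move=> x; apply: val_inj => /=; rewrite cE.
  exact: uv0.
have [k [ku _]] := coker _ c cv0.
have [i [_ iuniq]] := coker _ u uv0.
have ik : y = val (k y).
  rewrite -[LHS]/(idfun y) (iuniq idfun) //.
  rewrite -(iuniq (val \o k : {additive B -> B})) // => x /=.
  by have /= -> := ku x; rewrite cE.
by have /asboolP[x ux] := valP (k y); exists x; rewrite ux -ik.
Qed.

(** * Kernels of semimodules in terms of elements *)

Section KernelElements.
Variables (S : pzSemiRingType) (A B C : lSemiModType S).
Variables (f : {linear A -> B}) (g : {linear B -> C}).
Hypothesis ker : lsmod_kernel f g.

(** [S^o] is free on [1], so test maps out of it turn the universal property of a kernel into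
    statements about elements. *)
Lemma linear_ray (M : lSemiModType S) (m : M) :
  exists h : {linear S^o -> M}, forall s : S, h s = s *: m.
Proof.
apply: (@linear_of_semilinear S S^o M (fun s : S => s *: m)).
  by move=> s t; rewrite scalerDl.
by move=> s t; rewrite scalerA.
Qed.

(** The rays through [a] and [a'] have the same composite with [f], so uniqueness of the
    factorization makes them agree at [1]. *)
Lemma lsmod_kernel_injective : injective f.
Proof.
case: ker => gf0 kerP a a' faa'.
have [h hE] := linear_ray a; have [h' hE'] := linear_ray a'.
have [|k [_ kuniq]] := kerP S^o (f \o h); first by move=> s; exact: gf0.
have eh : h =1 k by apply: kuniq.
have eh' : h' =1 k.
  by apply: kuniq => s /=; rewrite hE hE' !linearZ /= faa'.
by rewrite -[a]scale1r -[a']scale1r -hE -hE' eh eh'.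
Qed.

Lemma lsmod_kernel_image b : g b = 0 -> exists a, f a = b.
Proof.
case: ker => gf0 kerP gb0.
have [h hE] := linear_ray b.
have [|k [fk _]] := kerP S^o h.
  by move=> s /=; rewrite hE linearZ /= gb0 scaler0.
by exists (k 1); rewrite -[LHS]/((f \o k) 1) fk hE scale1r.
Qed.

End KernelElements.

(** * Zero sums and torsion over the given semiring *)

Lemma idem_addr_eq0 (S : pzSemiRingType) (S_idem : forall s : S, s + s = s)
    (M : lSemiModType S) (m n : M) : m + n = 0 -> m = 0.
Proof.
move=> mn0; have mm : m + m = m.
  by rewrite -[m in LHS]scale1r -scalerDl S_idem scale1r.
(* [m = m + (m + n) = (m + m) + n = m + n = 0]. *)
by rewrite -[m]addr0 -mn0 addrA mm.
Qed.

Lemma torsion_free (S : pzSemiRingType) (S_idem : forall s : S, s + s = s)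
    (S_ideals : forall I : {pred S^o}, left_ideal I -> strongly_subtractive I ->
       I =i pred1 0 \/ I =i predT)
    (M : lSemiModType S) (s : S) (m : M) :
  s *: m = 0 -> s = 0 \/ m = 0.
Proof.
move=> sm0; pose ann : {pred S^o} := [pred t : S | t *: m == 0].
have [||E|E] := S_ideals ann.
- split; first split.
  + by rewrite inE scale0r.
  + by move=> t u; rewrite !inE scalerDl => /eqP-> /eqP->; rewrite addr0.
  + by move=> t u; rewrite !inE -scalerA => /eqP->; rewrite scaler0.
- move=> t u; rewrite !inE scalerDl => /eqP tu0; split; apply/eqP.
    exact: idem_addr_eq0 tu0.
  by rewrite addrC in tu0; exact: idem_addr_eq0 tu0.
(* A zero annihilator is tested on [s], a full one on [1]. *)
- left; apply/eqP; have := E s.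
  by rewrite !inE sm0 eqxx => <-.
- right; have := E 1.
  by rewrite !inE scale1r => /eqP.
Qed.

(** These conditions serve the scaling of the new point in [adjoin_oo]: respectively the unit law,
    distributivity over sums of scalars, and associativity. *)
Definition entire (S : pzSemiRingType) : Prop :=
  [/\ (1 : S) != 0, forall s t : S, s + t = 0 -> s = 0
    & forall s t : S, s * t = 0 -> s = 0 \/ t = 0].

(* [None] is the new absorbing point. *)
Definition adjoin_oo (S : pzSemiRingType) (entS : entire S)
  (M : lSemiModType S) : Type := option M.

(** * The semimodule with an adjoined absorbing point and its short exact sequence *)

Section AdjoinInfinity.
Variables (S : pzSemiRingType) (entS : entire S) (M : lSemiModType S).

Local Notation T := (adjoin_oo entS M).

HB.instance Definition _ := Choice.copy T (option M).

Definition adjoin_oo_add (x y : T) : T :=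
  if x is Some m then if y is Some n then Some (m + n) else None else None.

Definition adjoin_oo_scale (s : S) (x : T) : T :=
  if x is Some m then Some (s *: m) else if s == 0 then Some 0 else None.

Lemma adjoin_oo_addA : associative adjoin_oo_add.
Proof. by case=> [x|] [y|] [z|] //=; rewrite addrA. Qed.

Lemma adjoin_oo_addC : commutative adjoin_oo_add.
Proof. by case=> [x|] [y|] //=; rewrite addrC. Qed.

Lemma adjoin_oo_add0 : left_id (Some 0) adjoin_oo_add.
Proof. by case=> [x|] //=; rewrite add0r. Qed.

HB.instance Definition _ :=
  GRing.isNmodule.Build T adjoin_oo_addA adjoin_oo_addC adjoin_oo_add0.

Lemma adjoin_oo_scaleA s t (x : T) :
  adjoin_oo_scale s (adjoin_oo_scale t x) = adjoin_oo_scale (s * t) x.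
Proof.
have [_ _ domS] : entire S by [].
case: x => [m|] /=; first by rewrite scalerA.
have [->|t0] /= := eqVneq t 0; first by rewrite mulr0 eqxx scaler0.
have [->|s0] /= := eqVneq s 0; first by rewrite mul0r eqxx.
by case: eqVneq => // /domS[] /eqP; rewrite ?(negPf s0) ?(negPf t0).
Qed.

Lemma adjoin_oo_scale0 (x : T) : adjoin_oo_scale 0 x = 0.
Proof. by case: x => [m|] /=; rewrite ?scale0r ?eqxx. Qed.

Lemma adjoin_oo_scale1 : left_id 1 adjoin_oo_scale.
Proof.
have [/negPf one0 _ _] : entire S by [].
by case=> [m|] /=; rewrite ?scale1r ?one0.
Qed.

Lemma adjoin_oo_scaleDr : right_distributive adjoin_oo_scale +%R.
Proof.
move=> s x y.
have [->|s0] := eqVneq s 0; first by rewrite !adjoin_oo_scale0 addr0.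
by case: x y => [m|] [n|] /=; rewrite ?(negPf s0) //= scalerDr.
Qed.

Lemma adjoin_oo_scaleDl (x : T) :
  {morph adjoin_oo_scale^~ x : s t / s + t}.
Proof.
move=> s t; have [_ zsfS _] : entire S by [].
have [->|s0] := eqVneq s 0; first by rewrite adjoin_oo_scale0 !add0r.
have [->|t0] := eqVneq t 0; first by rewrite adjoin_oo_scale0 !addr0.
case: x => [m|] /=; first by rewrite scalerDl.
rewrite (negPf s0) (negPf t0).
by case: eqVneq => // /zsfS /eqP; rewrite (negPf s0).
Qed.

HB.instance Definition _ := GRing.Nmodule_isLSemiModule.Build S T
  adjoin_oo_scaleA adjoin_oo_scale0 adjoin_oo_scale1 adjoin_oo_scaleDr
  adjoin_oo_scaleDl.

Lemma adjoin_oo_inl : exists i : {linear M -> T}, forall m, i m = Some m.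
Proof. exact: (@linear_of_semilinear S M T Some). Qed.

End AdjoinInfinity.

Lemma adjoin_oo_map (S : pzSemiRingType) (entS : entire S)
    (M N : lSemiModType S) (f : {linear M -> N}) :
  exists F : {linear adjoin_oo entS M -> adjoin_oo entS N}, F =1 omap f.
Proof.
apply: linear_of_semilinear.
  by case=> [x|] [y|] //; congr Some; rewrite linearD.
move=> s [x|]; first by congr Some; rewrite linearZ.
rewrite /GRing.scale /=; case: ifP => // _.
by congr Some; rewrite linear0.
Qed.

(** Since ['rV[S]_0] is zero, the target of [g] has just two points, zero and the absorbing one; [g]
    collapses [M] to zero. *)
Lemma adjoin_oo_short_exact (S : pzSemiRingType) (entS : entire S)
    (M : lSemiModType S) (i : {linear M -> adjoin_oo entS M}) :
    (forall m, i m = Some m) ->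
  exists g : {linear adjoin_oo entS M -> adjoin_oo entS 'rV[S]_0},
    lsmod_short_exact i g.
Proof.
move=> iE; have [g gE] := adjoin_oo_map entS (\0 : {linear M -> 'rV[S]_0}).
(* [r] fixes the absorbing point and is a section of [g], so the factorization of a map [h] through
   [g] will be [h \o r]. *)
have [r rE] := adjoin_oo_map entS (\0 : {linear 'rV[S]_0 -> M}).
have gr x : g (r x) = x.
  by rewrite gE rE; case: x => [x|] //=; congr Some; apply/rowP; case.
exists g; split; split.
- by move=> m; rewrite /= iE gE.
(* The default [0] is never reached: [g] keeps [None] away from zero, so [h] avoids [None]. *)
- move=> D h gh0; pose k d := if h d is Some m then m else 0.
  have ik d : Some (k d) = h d.
    by rewrite /k; have := gh0 d; rewrite /= gE; case: (h d).
  have [|s d|K KE] := @linear_of_semilinear S D M k.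
  + by move=> d e; apply: Some_inj; rewrite ik linearD -!ik.
  + by apply: Some_inj; rewrite ik linearZ /= -ik.
  exists K; split=> [d|K' iK' d]; first by rewrite /= iE KE ik.
  by apply: Some_inj; rewrite KE ik -iE; exact: iK'.
- by move=> m; rewrite /= iE gE.
- move=> D h hi0; exists (h \o r); split=> [[m|]|k kg x] /=.
  + rewrite gE rE /= -!iE.
    by have /= -> := hi0 m; have /= -> := hi0 0.
  + by rewrite gE rE.
  + by rewrite -[x in LHS]gr; exact: kg.
Qed.

(** * An infinite element yields e-injectivity *)

Section InfinityInjective.
Variables (S : pzSemiRingType) (M : lSemiModType S) (oo : M).
Hypothesis S_idem : forall s : S, s + s = s.
Hypothesis S_tf : forall (C : lSemiModType S) (s : S) (c : C),
  s *: c = 0 -> s = 0 \/ c = 0.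
Hypothesis oo_infinite : infinite_element oo.
Hypothesis scale_oo : forall s : S, s != 0 -> s *: oo = oo.

Lemma extend_by_oo (A B C : lSemiModType S)
    (f : {linear A -> B}) (g : {linear B -> C}) (phi : {linear A -> M}) :
    lsmod_kernel f g ->
  exists psi : {linear B -> M},
    psi \o f =1 phi /\ forall b, g b != 0 -> psi b = oo.
Proof.
move=> ker; have gf0 a : g (f a) = 0 by case: ker => + _; exact.
have finj := lsmod_kernel_injective ker.
(* [p] chooses preimages under [f] on the zero set of [g]; its values elsewhere do not matter. *)
have [p pK] : {p : B -> A & forall b, g b = 0 -> f (p b) = b}.
  apply: (@choice _ _ (fun b a => g b = 0 -> f a = b)) => b.
  have [/(lsmod_kernel_image ker)[a <-]|gb] := eqVneq (g b) 0; first by exists a.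
  by exists 0 => gb0; rewrite gb0 eqxx in gb.
pose e b := if g b == 0 then phi (p b) else oo.
have [||psi psiE] := @linear_of_semilinear S B M e.
- move=> b b'; rewrite /e linearD.
  have [gb|gb] := eqVneq (g b) 0; have [gb'|gb'] := eqVneq (g b') 0.
  + rewrite gb gb' addr0 eqxx -linearD; congr (phi _).
    by apply: finj; rewrite linearD !pK // linearD gb gb' addr0.
  + by rewrite gb add0r (negPf gb') addrC oo_infinite.
  + by rewrite gb' addr0 (negPf gb) oo_infinite.
  (* A sum of two elements off the zero set of [g] stays off it, as zero sums in [C] are trivial. *)
  + rewrite oo_infinite; case: eqVneq => // /(idem_addr_eq0 S_idem) /eqP.
    by rewrite (negPf gb).
- move=> s b; rewrite /e linearZ /=.
  have [->|s0] := eqVneq s 0.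
    rewrite !scale0r eqxx -(linear0 phi); congr (phi _).
    by apply: finj; rewrite pK ?linear0.
  have [gb|gb] := eqVneq (g b) 0.
    rewrite gb scaler0 eqxx -linearZ /=; congr (phi _).
    by apply: finj; rewrite linearZ /= !pK // linearZ /= gb scaler0.
  (* Absence of torsion in [C] keeps nonzero multiples off the zero set of [g]. *)
  rewrite scale_oo //; case: eqVneq => // /S_tf[] /eqP.
    by rewrite (negPf s0).
  by rewrite (negPf gb).
exists psi; split=> [a|b gb]; rewrite ?/comp psiE /e.
  by rewrite gf0 eqxx; congr (phi _); apply: finj; rewrite pK.
by rewrite (negPf gb).
Qed.

Lemma infinity_e_injective : e_injective M.
Proof.
move=> A B C f g [ker [gf0 coker]].
(* [eta] is zero on the image of [f] and [oo] off it; being zero on that image, it factors through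
   [g] as [al]. *)
have [eta [etaf etaoo]] := extend_by_oo (\0 : {linear A -> M}) ker.
have [al [alg _]] := coker M eta etaf.
have gal : hom_map M g al = eta :> lsmod_hom B M by apply: hom_eqP.
split; split.
- by move=> phi; apply: hom_eqP => a /=; have /= -> := gf0 a; rewrite linear0.
- move=> D h hf0.
  have fac d : exists k : lsmod_hom C M, hom_map M g k = h d.
    have [|k [kg _]] := coker M (h d : {linear B -> M}).
      by move=> a; have /(congr1 (fun q : {linear A -> M} => q a)) := hf0 d.
    by exists k; apply: hom_eqP.
  (* A cokernel is epi: [k] and [k'] factor the same map through [g]. *)
  have ginj : injective (hom_map M g).
    move=> k k' kk'.
    have [|k0 [_ k0u]] := coker M (hom_map M g k : {linear B -> M}).
      by move=> a; rewrite /hom_map /=; have /= -> := gf0 a; rewrite linear0.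
    apply: hom_eqP => c; rewrite (k0u k) // -(k0u k') //.
    by rewrite kk'.
  have [k kE] := choice fac.
  have [|K KE] := @additive_of_morph D (lsmod_hom C M) k.
    split=> [|d d']; apply: ginj; first by rewrite kE !raddf0.
    by rewrite raddfD kE raddfD /= !kE.
  exists K; split=> [d|K' K'h d]; first by rewrite /= KE kE.
  by apply: ginj; rewrite KE kE; exact: K'h.
- by move=> phi; apply: hom_eqP => a /=; have /= -> := gf0 a; rewrite linear0.
- move=> D h h0.
  (* Adding [eta] changes nothing on the image of [f] and gives [oo] elsewhere, which erases the
     difference between two extensions. *)
  have absorb (p q : lsmod_hom B M) :
      hom_map M f p = hom_map M f q -> p + eta = q + eta :> lsmod_hom B M.
    move=> pq; apply: hom_eqP => b /=.
    have [/(lsmod_kernel_image ker)[a <-]|gb] := eqVneq (g b) 0.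
      congr (_ + _).
      by have /(congr1 (fun r : {linear A -> M} => r a)) := pq.
    by rewrite etaoo // ![_ + oo]addrC !oo_infinite.
  have h_wd (p q : lsmod_hom B M) : hom_map M f p = hom_map M f q -> h p = h q.
    (* [h] kills [eta], which comes from [al], so adding [eta] does not affect values of [h]. *)
    move=> pq; have heta : h eta = 0 by rewrite -gal; exact: h0.
    by rewrite -[h p]addr0 -[h q]addr0 -heta -!raddfD (absorb p q).
  have lift phi : exists psi : lsmod_hom B M, hom_map M f psi = phi.
    have [psi [psif _]] := extend_by_oo (phi : {linear A -> M}) ker.
    by exists psi; apply: hom_eqP.
  (* The chosen extensions [l] need not be additive, but [h \o l] is, by [h_wd]. *)
  have [l lE] := choice lift.
  have [|K KE] := @additive_of_morph (lsmod_hom A M) D (h \o l).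
    split=> [|p q] /=; first by rewrite -(raddf0 h); apply: h_wd; rewrite lE raddf0.
    by rewrite -raddfD; apply: h_wd; rewrite lE raddfD /= !lE.
  exists K; split=> [p|K' K'f p].
    by rewrite /= KE; apply: h_wd; rewrite lE.
  by rewrite KE -[p in LHS]lE; exact: K'f.
Qed.

End InfinityInjective.

Theorem proposition4p3 (S : pzSemiRingType)
    (S_idem : forall s : S, s + s = s)
    (S_ideals : forall I : {pred S^o}, left_ideal I -> strongly_subtractive I ->
       I =i pred1 0 \/ I =i predT)
    (M : lSemiModType S) :
  e_injective M <->
  exists oo : M, infinite_element oo /\ forall s : S, s != 0 -> s *: oo = oo.
Proof.
have tf := torsion_free S_idem S_ideals.
split=> [Minj|[oo [oo_inf oo_scale]]]; last first.
  exact: (infinity_e_injective S_idem tf oo_inf).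
(* If [1 = 0], then [M] is zero and [0] itself is the required element. *)
have [one0|one0] := eqVneq (1 : S) 0.
  have M0 (m : M) : m = 0 by rewrite -[m]scale1r one0 scale0r.
  by exists 0; split=> [m|s _]; rewrite [LHS]M0.
have entS : entire S.
  split=> // [s t|s t]; first exact: (@idem_addr_eq0 S S_idem S^o).
  exact: (tf S^o).
have [i iE] := adjoin_oo_inl entS M.
have [g ex] := adjoin_oo_short_exact iE.
have [_ /nmod_cokernel_surjective surj] := Minj _ _ _ _ _ ex.
(* Lifting the identity gives a retraction [r] of [adjoin_oo entS M] onto [M], which carries the
   laws of the absorbing point over to its image. *)
have [r ri] := surj (idfun : {linear M -> M}).
have {}ri m : (r : {linear _ -> M}) (Some m) = m.
  rewrite -iE.
  by have /(congr1 (fun q : {linear M -> M} => q m)) := ri.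
pose x : adjoin_oo entS M := None.
exists ((r : {linear _ -> M}) x); split=> [m|s s0].
  by rewrite -[m in LHS]ri -linearD.
by rewrite -linearZ /= /GRing.scale /= (negPf s0).
Qed.
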